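(* Let $\mathcal{S}=(X,\phi,q)$ be a max-plus IFS, with Mañé potential $S:X\times X\to[-\infty,0]$ and Aubry set $\Omega$. Suppose that a function $\overline{\lambda}:X\to[-\infty,0]$ satisfies $\bigoplus_{x\in X}\overline{\lambda}(x)=0$ and $$\overline{\lambda}(x)=\bigoplus_{z\in\Omega}\big(S(x,z)\odot\overline{\lambda}(z)\big)\quad\text{for all }x\in X.$$ Then the functional $\overline{\mu}\in C^*(X,\mathbb{R})$ defined by $\overline{\mu}(f):=\bigoplus_{x\in X}(\overline{\lambda}(x)\odot f(x))$ is an idempotent probability which is invariant for the operator $M_{\phi,q}$. Reciprocally, if $\mu\in I(X)$ is invariant for $M_{\phi,q}$ and $\lambda\in U(X,\mathbb{R}_{\max})$ is its (unique upper semi-continuous) density, then $\lambda$ satisfies $$\lambda(x)=\bigoplus_{z\in\Omega}[S(x,z)\odot\lambda(z)]\quad\text{for all }x\in X.$$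
   Context: Notation: $\mathbb{R}_{\max}=\mathbb{R}\cup\{-\infty\}$, $a\oplus b=\max(a,b)$, $a\odot b=a+b$ with $a\odot(-\infty)=-\infty$; $\bigoplus_{i\in A}$ denotes the supremum over $i\in A$, equal to $-\infty$ if $A=\varnothing$. For a compact metric space $X$, $C(X,\mathbb{R})$ is the set of continuous real functions, and $C^*(X,\mathbb{R})$ is the set of all $m:C(X,\mathbb{R})\to\mathbb{R}$ with $m(a\odot f)=a\odot m(f)$ and $m(f\oplus g)=m(f)\oplus m(g)$ for all $a\in\mathbb{R}$, $f,g\in C(X,\mathbb{R})$ (operations on functions are pointwise). $I(X)$ is the set of $m\in C^*(X,\mathbb{R})$ with $m(0)=0$ (idempotent probabilities). $U(X,\mathbb{R}_{\max})$ is the set of upper semi-continuous functions $\lambda:X\to\mathbb{R}_{\max}$ that are not identically $-\infty$. Every $\mu\in C^*(X,\mathbb{R})$ has a unique $\lambda\in U(X,\mathbb{R}_{\max})$, called its density, with $\mu(f)=\bigoplus_{x\in X}\lambda(x)\odot f(x)$ for all $f\in C(X,\mathbb{R})$. A max-plus IFS (mpIFS) $\mathcal{S}=(X,\phi,q)$ consists of compact metric spaces $(X,d_X)$, $(J,d_J)$, maps $\phi_j:X\to X$ ($j\in J$) and functions $q_j:X\to\mathbb{R}$ ($j\in J$) such that: there is $0<\gamma<1$ with $d_X(\phi_{j_1}(x_1),\phi_{j_2}(x_2))\le\gamma[d_J(j_1,j_2)+d_X(x_1,x_2)]$ for all $j_1,j_2\in J$, $x_1,x_2\in X$; there is $C>0$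 with $|q_j(x_1)-q_j(x_2)|\le C\,d_X(x_1,x_2)$ for all $j\in J$, $x_1,x_2\in X$; $\bigoplus_{j\in J}q_j(x)=0$ for all $x\in X$; and $q(j,x)=q_j(x)$ is continuous on $J\times X$. Write $\phi(j,x)=\phi_j(x)$. The operator $M_{\phi,q}:I(X)\to I(X)$ is $M_{\phi,q}(\mu)(f)=\bigoplus_{j\in J}\mu(q_j\odot(f\circ\phi_j))$, $f\in C(X,\mathbb{R})$; $\mu$ is invariant if $M_{\phi,q}(\mu)=\mu$. For $n\in\mathbb{N}=\{1,2,\dots\}$, $\omega=(j_1,\dots,j_n)\in J^n$ and $x\in X$, put $\phi_\omega(x)=\phi_{j_1}\circ\cdots\circ\phi_{j_n}(x)$ and $\mathrm{Sum}(\omega,x)=q_{j_1}(\phi_{(j_2,\dots,j_n)}(x))+q_{j_2}(\phi_{(j_3,\dots,j_n)}(x))+\cdots+q_{j_n}(x)$. For $\varepsilon>0$, $S_\varepsilon(x,y)=\bigoplus_{n\in\mathbb{N}}\bigoplus_{\omega\in J^n,\ d_X(x,\phi_\omega(y))<\varepsilon}\mathrm{Sum}(\omega,y)$. The Mañé potential is $S(x,y)=\lim_{\varepsilon\to0}S_\varepsilon(x,y)\in[-\infty,0]$, and the Aubry set is $\Omega=\{x\in X: S(x,x)=0\}$. *)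

(* Defs.v *)
From HB Require Import structures.
From mathcomp Require Import all_boot all_order all_algebra.
From mathcomp Require Import all_classical all_reals all_analysis.

Set Implicit Arguments.
Unset Strict Implicit.
Unset Printing Implicit Defensive.

Import Order.TTheory GRing.Theory Num.Theory.
Import numFieldNormedType.Exports.

Local Open Scope classical_set_scope.
Local Open Scope ring_scope.

(* Conventions: an element of R_max is an element of \bar R different from
   +oo; the max-plus sum over a set is ereal_sup (equal to -oo on set0), and
   the max-plus product is the addition of \bar R.  A functional on C(X, R) is
   a function on the library's type continuousType X R. *)

Section ContinuousOperations.
Context {R : realType} {X : topologicalType}.
Implicit Types f g : continuousType X R.

Lemma cts_add f g : continuous (f \+ g).
Proof. by move=> x; apply: continuousD; exact: cts_fun. Qed.

HB.instance Definition _ f g :=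
  @isContinuous.Build X R (f \+ g) (@cts_add f g).

Lemma cts_max f g : continuous (f \max g).
Proof. by move=> x; apply: continuous_max; exact: cts_fun. Qed.

HB.instance Definition _ f g :=
  @isContinuous.Build X R (f \max g) (@cts_max f g).

End ContinuousOperations.

Section IdempotentProbabilities.
Context {R : realType} {X : topologicalType}.
Implicit Types (f g : continuousType X R) (m : continuousType X R -> R)
  (lam : X -> \bar R).

Definition maxplus_linear m : Prop :=
  (forall (a : R) f, m (cst a \+ f) = a + m f) /\
  (forall f g, m (f \max g) = Num.max (m f) (m g)).

Definition idempotent_probability m : Prop :=
  maxplus_linear m /\ m (cst 0) = 0.

Definition upper_semicontinuous lam : Prop :=
  lower_semicontinuous (fun x => - lam x)%E.

Definition usc_Rmax lam : Prop :=
  [/\ forall x, lam x != +oo%E, upper_semicontinuous lam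
    & exists x, lam x != -oo%E].

(* The right-hand side is computed in \bar R; the equation says in particular
   that it is finite. *)
Definition represents lam m : Prop :=
  forall f, (m f)%:E = ereal_sup [set (lam x + (f x)%:E)%E | x in [set: X]].

Definition density lam m : Prop := usc_Rmax lam /\ represents lam m.

End IdempotentProbabilities.

Record mpIFS (R : realType) (X J : metricType R) := MpIFS {
  phi : J -> X -> X;
  q : J -> X -> R;
  mpIFS_compact_space : compact [set: X];
  mpIFS_compact_index : compact [set: J];
  mpIFS_contractive : exists2 gamma : R, 0 < gamma < 1 &
    forall j1 j2 x1 x2,
      mdist (phi j1 x1) (phi j2 x2) <= gamma * (mdist j1 j2 + mdist x1 x2);
  mpIFS_lipschitz : exists2 C : R, 0 < C &
    forall j x1 x2, `|q j x1 - q j x2| <= C * mdist x1 x2;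
  mpIFS_normalized : forall x, ereal_sup [set (q j x)%:E | j in [set: J]] = 0%E;
  mpIFS_continuous : continuous (fun p : J * X => q p.1 p.2)
}.

Section MaxPlusIFS.
Context {R : realType} {X J : metricType R} (S : mpIFS X J).

Lemma mpIFS_phi_continuous j : continuous (phi S j).
Proof.
have [gamma /andP[g0 g1] H] := mpIFS_contractive S.
move=> x; apply/metricType_numDomainType.cvgrPdist_lt => e e0.
apply: filterS (nbhsx_ballx x e e0) => y.
rewrite ballEmdist /= => xy; apply: le_lt_trans (H j j x y) _.
rewrite mdistxx add0r; apply: le_lt_trans xy.
by rewrite ler_piMl ?mdist_ge0// ltW.
Qed.

Lemma mpIFS_q_continuous j : continuous (q S j).
Proof.
move=> x; have h : (fun y : X => (j, y)) @ x --> (j, x).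
  by apply: cvg_pair; [exact: cvg_cst|exact: cvg_id].
exact: (@continuous_comp _ _ _ (pair j) (fun p => q S p.1 p.2) x h
  (@mpIFS_continuous _ _ _ S (j, x))).
Qed.

HB.instance Definition _ j :=
  @isContinuous.Build X X (phi S j) (@mpIFS_phi_continuous j).
HB.instance Definition _ j :=
  @isContinuous.Build X R (q S j) (@mpIFS_q_continuous j).

(* Valued in \bar R, so that no finiteness has to be assumed on mu; on
   idempotent probabilities the supremum is finite (X is compact). *)
Definition Mop (mu : continuousType X R -> R) (f : continuousType X R)
    : \bar R :=
  ereal_sup [set (mu (q S j \+ (f \o phi S j)))%:E | j in [set: J]].

Definition invariant_functional (mu : continuousType X R -> R) : Prop :=
  forall f, Mop mu f = (mu f)%:E.

(* phi_word (j_1, ..., j_n) = phi_(j_1) o ... o phi_(j_n), and sum_word is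
   Sum; the empty word gives the identity and 0. *)
Fixpoint phi_word (w : seq J) (x : X) : X :=
  if w is j :: w' then phi S j (phi_word w' x) else x.

Fixpoint sum_word (w : seq J) (x : X) : R :=
  if w is j :: w' then q S j (phi_word w' x) + sum_word w' x else 0.

Definition mane_eps (eps : R) (x y : X) : \bar R :=
  ereal_sup [set ereal_sup [set (sum_word w y)%:E |
      w in [set w : n.-tuple J | mdist x (phi_word w y) < eps]]
    | n in [set n : nat | (0 < n)%N]].

Definition mane (x y : X) : \bar R := lim (mane_eps e x y @[e --> 0^'+]).

Definition Aubry : set X := [set x | mane x x = 0%E].

End MaxPlusIFS.

(* Main.v *)
Require Import Defs.
From HB Require Import structures.
From mathcomp Require Import all_boot all_order all_algebra.
From mathcomp Require Import all_classical all_reals all_analysis.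
From mathcomp Require Import ring lra.

Set Implicit Arguments.
Unset Strict Implicit.

Import Order.TTheory GRing.Theory Num.Theory.
Import numFieldNormedType.Exports.

Local Open Scope classical_set_scope.
Local Open Scope ring_scope.

(** Everything rests on one inequality.  Call [lam] superinvariant when
[lam x + q_j x <= lam (phi_j x)]; iterating, [lam z + Sum(w, z)] is at most
[lam (phi_w z)] for every word [w].

From the Aubry set to invariance.  The map [S(-, z)] is superinvariant
([mane_phi]): prepending [j] to a word ending near [x] gives a word ending near
[phi_j x], and changes the sum by almost [q_j x].  Hence so is any
[lam = sup_z (S(-, z) + lam z)], which gives [M(mu) <= mu].  For the converse
inequality, the definition of [S(x, z)] provides a nonempty word [w = j w'] with
[phi_w z] close to [x] and [Sum(w, z)] almost at least [S(x, z)]; the point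
[y = phi_w' z] satisfies [lam y >= Sum(w', z) + lam z], so the value at
[(j, y)] of the expression defining [M(mu)(f)] is almost [lam x + f x]
([invariant_of_mane]).

From invariance to the Aubry set.  Testing the equation [M(mu) = mu] on the
peaks [y |-> - K d(x, y)] with [K] large isolates the density at [x]: upper
semicontinuity turns [M(mu) <= mu] into superinvariance of [lam], and
compactness of [J * X] turns [M(mu) >= mu] into the existence, for each [x]
with [lam x] finite, of [j] and [y] with [phi_j y = x] and
[lam y + q_j y >= lam x] ([exact_preimage]).  Superinvariance and upper
semicontinuity give [S(x, z) + lam z <= lam x] for all [z] ([mane_add_le]).
For equality, iterate exact preimages to get a backward orbit
[x = x_0, x_1, ...].  Along it [lam (x_n)] is nondecreasing and bounded by [0],
so it converges to some [l], and the word joining [x_n] to [x_m] has sum at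
least [lam (x_m) - lam (x_n)], which is close to [0] for large [m < n].  Let [z]
be a cluster point of the orbit.  Since the sums over words are uniformly
Lipschitz ([sum_word_lipschitz]), the end points [x_n] can be replaced by [z],
which gives both [S(z, z) = 0] and [S(x, z) >= lam x - l]; upper semicontinuity
gives [lam z >= l], whence [S(x, z) + lam z >= lam x] ([aubry_attains]). *)

(** * Extended reals, sequences and semicontinuity *)

Section Preliminaries.
Context {R : realType}.

Lemma lee_of_reals (a b : \bar R) :
  (forall r : R, (r%:E <= a -> r%:E <= b)%E) -> (a <= b)%E.
Proof.
case: a => [a h| h|_]; [exact: h| |exact: leNye].
case: b h => [b|//|] h.
  by have := h (b + 1) (leey _); rewrite lee_fin gerDl ler10.
by have := h 0 (leey _).
Qed.

Lemma lee_of_lt_reals (a : \bar R) (r : R) :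
  (forall c : R, (a < c%:E)%E -> r <= c) -> (r%:E <= a)%E.
Proof.
case: a => [a h| _|h]; [|exact: leey|].
  rewrite lee_fin; apply/ler_addgt0Pr => e e0; apply: h.
  by rewrite lte_fin ltrDl.
by have := h (r - 1) (ltNyr _); rewrite lerBrDr gerDl ler10.
Qed.

(** Stated with neighborhoods, this applies to the product [J * X], and what is
used of a convergent subsequence holds without extracting one. *)
Lemma cluster_sequence (T : topologicalType) (u : nat -> T) :
  compact [set: T] ->
  exists p : T, forall V, nbhs p V -> forall N, exists2 n, (N <= n)%N & V (u n).
Proof.
move=> /(_ (u @ \oo) _ filterT) [p [_ pu]]; exists p => V pV N.
have uN : (u @ \oo) [set u n | n in [set n | (N <= n)%N]].
  by exists N => // n Nn; exists n.
by have [_ [[n /= Nn <-] Vn]] := pu _ _ uN pV; exists n.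
Qed.

Lemma usc_near (X : topologicalType) (lam : X -> \bar R) x (c : R) :
  upper_semicontinuous lam -> (lam x < c%:E)%E ->
  \forall y \near x, (lam y < c%:E)%E.
Proof.
move=> ulam lxc; have [|V xV hV] := ulam x (- c).
  by rewrite EFinN lteN2.
by apply: filterS xV => y /hV; rewrite EFinN lteN2.
Qed.

End Preliminaries.

(** * Balls and peaks *)

Section Peaks.
Context {R : realType} {X : metricType R}.

Lemma near_mdist (x : X) (P : set X) : nbhs x P ->
  exists2 d : R, 0 < d & forall y, mdist x y < d -> P y.
Proof.
move=> /nbhs_ballP[d /= d0 h]; exists d => // y xy.
by apply: h; rewrite ballEmdist.
Qed.

(** An untruncated cone is enough to localize at [x], because densities of
idempotent probabilities are bounded above by [0]. *)
Definition peak (K : R) (x y : X) : R := - (K * mdist x y).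

Lemma peak_continuous K x : continuous (peak K x).
Proof.
move=> y; apply: cvgN; apply: cvgMr; apply/cvgrPdist_lt => e e0.
apply: filterS (nbhsx_ballx y e e0) => z; rewrite ballEmdist /= => yz.
apply: le_lt_trans yz; rewrite ler_norml.
have := metric_triangle x y z; have := metric_triangle x z y.
by rewrite (metric_sym z y); lra.
Qed.

HB.instance Definition _ K x :=
  @isContinuous.Build X R (peak K x) (@peak_continuous K x).

End Peaks.

(** * Words: contraction, distortion and superinvariance *)

Section Words.
Context {R : realType} {X J : metricType R} (S : mpIFS X J).

Lemma q_le0 j x : q S j x <= 0.
Proof.
rewrite -lee_fin -[leRHS](mpIFS_normalized S x).
by apply: ereal_sup_ubound; exists j.
Qed.

Lemma sum_word_le0 w x : sum_word S w x <= 0.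
Proof. by elim: w => //= j w IH; have := q_le0 j (phi_word S w x); lra. Qed.

Lemma phi_nonexpansive j x y : mdist (phi S j x) (phi S j y) <= mdist x y.
Proof.
have [g /andP[g0 g1] H] := mpIFS_contractive S.
apply: le_trans (H j j x y) _; rewrite mdistxx add0r.
by rewrite ler_piMl ?mdist_ge0// ltW.
Qed.

Lemma phi_word_nonexpansive w x y :
  mdist (phi_word S w x) (phi_word S w y) <= mdist x y.
Proof.
by elim: w => //= j w; apply: le_trans; exact: phi_nonexpansive.
Qed.

(** The maps contract by [g < 1], so the letter applied after [k] others
contributes at most [C g^k d(x, y)] and the geometric series bounds the constant independently of
the length of the word. *)
Lemma sum_word_lipschitz : exists2 C : R, 0 < C &
  forall w x y, `|sum_word S w x - sum_word S w y| <= C * mdist x y.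
Proof.
have [g /andP[g0 g1] Hg] := mpIFS_contractive S.
have [C C0 HC] := mpIFS_lipschitz S.
have g1' : 0 < 1 - g by lra.
(* the sum of the geometric series, characterized by D = C + D g *)
pose D := C / (1 - g); have D0 : 0 < D by rewrite divr_gt0.
have DE : C + D * g = D by rewrite /D; field; lra.
exists D => // w x y.
(* with the current distance added, the bound is preserved by each letter *)
suff: `|sum_word S w x - sum_word S w y|
      + D * mdist (phi_word S w x) (phi_word S w y) <= D * mdist x y.
  have := mdist_ge0 (phi_word S w x) (phi_word S w y).
  by move=> /(mulr_ge0 (ltW D0)); lra.
elim: w => [|j w] /=; first by rewrite subrr normr0 add0r.
apply: le_trans.
set x' := phi_word S w x; set y' := phi_word S w y.
have h1 : D * mdist (phi S j x') (phi S j y') <= D * g * mdist x' y'.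
  rewrite -mulrA ler_pM2l//; have := Hg j j x' y'; by rewrite mdistxx add0r.
have h2 := HC j x' y'.
have h3 : D * mdist x' y' = C * mdist x' y' + D * g * mdist x' y'.
  by rewrite -mulrDl DE.
have h4 := ler_normD (q S j x' - q S j y') (sum_word S w x - sum_word S w y).
rewrite [X in `|X| + _](_ : _ =
  (q S j x' - q S j y') + (sum_word S w x - sum_word S w y)); last by lra.
lra.
Qed.

(** This is the inequality [M(mu) <= mu] read on densities. *)
Definition superinvariant (lam : X -> \bar R) : Prop :=
  forall j x, (lam x + (q S j x)%:E <= lam (phi S j x))%E.

Lemma superinvariant_word lam w x : superinvariant lam ->
  (lam x + (sum_word S w x)%:E <= lam (phi_word S w x))%E.
Proof.
move=> hlam; elim: w => [|j w IH] /=; first by rewrite adde0.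
apply: le_trans (hlam _ _); rewrite EFinD [(_%:E + _)%E]addeC addeA.
exact: leeD2r.
Qed.

End Words.

(** * The Mane potential *)

Section Mane.
Context {R : realType} {X J : metricType R} (S : mpIFS X J).

(** [mane_eps] is nondecreasing in its radius, so the limit defining the
potential exists and is an infimum. *)
Lemma mane_infE x y :
  mane S x y = ereal_inf [set mane_eps S e x y | e in [set e : R | 0 < e]].
Proof.
have -> : [set e : R | 0 < e] =
    [set` Interval (BRight (0 : R)) (BInfty _ false)].
  by apply/seteqP; split=> e /=; rewrite in_itv/= andbT.
apply: cvg_lim => //.
apply: (@nondecreasing_at_right_cvge _ (fun e => mane_eps S e x y)) => //.
move=> e e' _ _ ee'; apply: ge_ereal_sup => _ [n /= n0 <-].
apply: ge_ereal_sup => _ [w /= dw <-].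
apply: le_trans (ereal_sup_ubound _); last by exists n.
apply: ereal_sup_ubound; exists w => //=; exact: lt_le_trans ee'.
Qed.

(** A lower bound on the potential is a family of words; all uses of the
potential go through this equivalence, which removes the suprema and the
limit. *)
Lemma mane_geP (r : R) x y : (r%:E <= mane S x y)%E <->
  forall e, 0 < e -> exists w, [/\ (0 < size w)%N,
    mdist x (phi_word S w y) < e & r - e < sum_word S w y].
Proof.
rewrite mane_infE; split=> [/ereal_infP h e e0|h].
  have : ((r - e)%:E < mane_eps S e x y)%E.
    apply: lt_le_trans (h _ (ex_intro2 _ _ e e0 erefl)).
    by rewrite lte_fin; lra.
  move=> /ereal_sup_gt[_ [n /= n0 <-]] /ereal_sup_gt[_ [w /= dw <-]].
  by rewrite lte_fin => rw; exists w; split=> //; rewrite size_tuple.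
apply/ereal_infP => _ [e /= e0 <-]; apply/lee_addgt0Pr => e' e'0.
have [|w [w0 dw rw]] := h (Num.min e e'); first by rewrite lt_min e0.
apply: (@le_trans _ _ ((sum_word S w y)%:E + e'%:E)%E).
  have : Num.min e e' <= e' by rewrite ge_min lexx orbT.
  by rewrite -EFinD lee_fin; move: rw; lra.
apply: leeD2r; apply: le_trans (ereal_sup_ubound _); last by exists (size w).
apply: ereal_sup_ubound; exists (in_tuple w) => //=.
by rewrite (lt_le_trans dw)// ge_min lexx.
Qed.

Lemma mane_le0 x y : (mane S x y <= 0)%E.
Proof.
apply: lee_of_reals => r /mane_geP h; apply/lee_addgt0Pr => e /h[w [_ _]].
by have := sum_word_le0 S w y; rewrite add0e lee_fin; lra.
Qed.

(** A word going from [z] to near [x] extends by [j] to one going from [z] to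
near [phi_j x]; the Lipschitz bound on [q_j] controls the error made in reading
[q_j] at the end of the word instead of at [x]. *)
Lemma mane_phi j x z :
  (mane S x z + (q S j x)%:E <= mane S (phi S j x) z)%E.
Proof.
have [C C0 HC] := mpIFS_lipschitz S.
rewrite -leeBrDr//; apply: lee_of_reals => r /mane_geP h.
rewrite leeBrDr// -EFinD; apply/mane_geP => e e0.
have C1 : 0 < 1 + C by lra.
(* the sum is off by d from its own slack and by C * d from q_j *)
pose d := e / (1 + C); have d0 : 0 < d by rewrite divr_gt0.
have ed : e = d + C * d by rewrite /d; field; lra.
have Cd : 0 < C * d by rewrite mulr_gt0.
have [w [w0 dw rw]] := h _ d0; exists (j :: w); split=> //=.
  by apply: le_lt_trans (phi_nonexpansive S j _ _) _; lra.
have : C * mdist x (phi_word S w z) <= C * d by rewrite ler_pM2l// ltW.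
have := HC j x (phi_word S w z); rewrite ler_norml; lra.
Qed.

End Mane.

(** * Functionals represented by a density *)

Section Functionals.
Context {R : realType} {X : topologicalType}.
Implicit Types (f : continuousType X R) (m : continuousType X R -> R)
  (lam : X -> \bar R).

(** This lemma and the next two restate the supremum formula with real numbers
only: a value [-oo] of the density imposes nothing, so quantifying over real
[r <= lam x] avoids all case distinctions. *)
Lemma represents_ge lam m f x (r : R) : represents lam m ->
  (r%:E <= lam x)%E -> r + f x <= m f.
Proof.
move=> lm rx; rewrite -lee_fin lm EFinD; apply: le_trans (leeD2r _ rx) _.
by apply: ereal_sup_ubound; exists x.
Qed.

Lemma represents_le lam m f (c : R) : represents lam m ->
  (forall x (r : R), (r%:E <= lam x)%E -> r + f x <= c) -> m f <= c.
Proof.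
move=> lm h; rewrite -lee_fin lm; apply: ge_ereal_sup => _ [x _ <-].
rewrite -leeBrDr//; apply: lee_of_reals => r /h.
by rewrite leeBrDr// -EFinD lee_fin.
Qed.

Lemma represents_gt lam m f (c : R) : represents lam m -> c < m f ->
  exists x, exists2 r : R, (r%:E <= lam x)%E & c < r + f x.
Proof.
move=> lm cm; apply: contrapT => h; move: cm; rewrite ltNge => /negP; apply.
apply: (represents_le lm) => x r rx; rewrite leNgt; apply/negP => cr.
by apply: h; exists x, r.
Qed.

Lemma represents_linear lam m : represents lam m -> maxplus_linear m.
Proof.
move=> lm; split=> [a f|f g].
  apply/eqP; rewrite eq_le; apply/andP; split.
    apply: (represents_le lm) => x r rx /=.
    by have := represents_ge f lm rx; rewrite /cst; lra.
  rewrite -lerBrDl; apply: (represents_le lm) => x r rx.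
  by have := represents_ge (cst a \+ f) lm rx; rewrite /= /cst; lra.
apply/eqP; rewrite eq_le; apply/andP; split.
  apply: (represents_le lm) => x r rx /=.
  have := represents_ge f lm rx; have := represents_ge g lm rx.
  by rewrite /Order.max_fun/= addr_maxr ge_max !le_max => -> ->; rewrite orbT.
rewrite ge_max; apply/andP; split; apply: (represents_le lm) => x r rx.
  apply: le_trans (represents_ge (f \max g) lm rx).
  by rewrite lerD2l /= le_max lexx.
apply: le_trans (represents_ge (f \max g) lm rx).
by rewrite lerD2l /= le_max lexx orbT.
Qed.

Lemma represents_cst0 lam m : represents lam m ->
  (m (cst 0))%:E = ereal_sup [set lam x | x in [set: X]].
Proof.
move=> ->; congr (ereal_sup _); congr (image _ _).
by apply/funext => x; rewrite adde0.
Qed.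

(** The supremum is finite: it is at most the maximum of [f], and [lam] has a
finite value. *)
Lemma represents_exists lam : compact [set: X] ->
  ereal_sup [set lam x | x in [set: X]] = 0%E -> exists m, represents lam m.
Proof.
move=> cX lam0.
pose F f := ereal_sup [set (lam x + (f x)%:E)%E | x in [set: X]].
exists (fun f => fine (F f)) => f; apply: fineK.
have lam_le0 x : (lam x <= 0)%E.
  by rewrite -lam0; apply: ereal_sup_ubound; exists x.
have : ((-1)%:E < ereal_sup [set lam x | x in [set: X]])%E.
  by rewrite lam0 lte_fin ltrN10.
move=> /ereal_sup_gt[_ [x0 _ <-]] lamx0.
have [|c _ fc] := @compact_EVT_max X R f setT _ cX
  (continuous_subspaceT (@cts_fun _ _ f)).
  by exists x0.
apply/fin_real/andP; split.
  apply: (@lt_le_trans _ _ (lam x0 + (f x0)%:E)%E); last first.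
    by apply: ereal_sup_ubound; exists x0.
  by case: (lam x0) lamx0 => [r| |] //= _; rewrite ?ltNyr.
apply: (@le_lt_trans _ _ (f c)%:E); last exact: ltry.
apply: ge_ereal_sup => _ [x _ <-]; rewrite -[leRHS]add0e; apply: leeD => //.
by rewrite lee_fin; apply: fc; rewrite inE.
Qed.

End Functionals.

(** * Densities generated by the Aubry set are invariant *)

Section FromAubrySet.
Context {R : realType} {X J : metricType R} (S : mpIFS X J).

Lemma superinvariant_of_mane (lam : X -> \bar R) :
  (forall x, lam x = ereal_sup [set (mane S x z + lam z)%E | z in Aubry S]) ->
  superinvariant S lam.
Proof.
move=> H j x; rewrite {1}(H x) -leeBrDr//; apply: ge_ereal_sup => _ [z zA <-].
rewrite leeBrDr// addeAC; apply: le_trans (leeD2r _ (mane_phi S j x z)) _.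
by rewrite (H (phi S j x)); apply: ereal_sup_ubound; exists z.
Qed.

(** One inequality is superinvariance.  For the other one, a word that almost
realizes [S(x, z)] is nonempty; its first letter [j] and the point [y] reached
by the remaining ones almost realize [lam x + f x]. *)
Lemma invariant_of_mane (lam : X -> \bar R) mu :
  (forall x, (lam x <= 0)%E) -> represents lam mu ->
  (forall x, lam x = ereal_sup [set (mane S x z + lam z)%E | z in Aubry S]) ->
  invariant_functional S mu.
Proof.
move=> lam0 lm H f; have hlam := superinvariant_of_mane H.
apply/eqP; rewrite eq_le; apply/andP; split.
  apply: ge_ereal_sup => _ [j _ <-]; rewrite lee_fin.
  apply: (represents_le lm) => x r rx /=; rewrite addrA.
  apply: (represents_ge f lm); apply: le_trans (hlam j x).
  by rewrite EFinD leeD2r.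
apply: lee_of_lt_reals => c Mc; apply: (represents_le lm) => x r rx.
(* errors: choice of z, near-optimality of the word, continuity of f *)
apply/ler_addgt0Pr => e e0; have e3 : 0 < e / 3 by lra.
have : ((r - e / 3)%:E < lam x)%E.
  by apply: lt_le_trans rx; rewrite lte_fin; lra.
rewrite {1}H => /ereal_sup_gt[_ [z _ <-]].
case Es : (mane S x z) (mane_le0 S x z) => [s| |]//= _.
case Et : (lam z) (lam0 z) => [t| |]//= _.
rewrite -EFinD lte_fin => rst.
have /cvgrPdist_lt/(_ _ e3)/near_mdist[d d0 fd] := @cts_fun _ _ f x.
have /mane_geP hs : (s%:E <= mane S x z)%E by rewrite Es.
have [|w [w0 dw sw]] := hs (Num.min d (e / 3)); first by rewrite lt_min d0.
case: w w0 dw sw => [//|j w] _ /=; set y := phi_word S w z.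
rewrite lt_min => /andP[dw _] sw.
have {}sw : s - e / 3 < q S j y + sum_word S w z.
  by apply: le_lt_trans sw; rewrite lerD2l lerN2 ge_min lexx orbT.
have ty : ((t + sum_word S w z)%:E <= lam y)%E.
  by rewrite EFinD -Et; exact: superinvariant_word.
have := represents_ge (q S j \+ (f \o phi S j)) lm ty.
have : mu (q S j \+ (f \o phi S j)) < c.
  by rewrite -lte_fin; apply: le_lt_trans Mc; apply: ereal_sup_ubound; exists j.
have := fd _ dw; rewrite ltr_norml /=.
lra.
Qed.

End FromAubrySet.

(** * Densities of invariant functionals *)

Section Invariant.
Context {R : realType} {X J : metricType R} (S : mpIFS X J).
Context (mu : continuousType X R -> R) (lam : X -> \bar R)
  (lam_le0 : forall x, (lam x <= 0)%E)
  (ulam : upper_semicontinuous lam) (lm : represents lam mu).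

(** Upper semicontinuity makes [lam < c] on a ball around [x]; outside it the
peak is at most [- |c|]. *)
Lemma represents_peak x (c : R) :
  (lam x < c%:E)%E -> exists K, mu (peak K x) <= c.
Proof.
move=> xc; have [d d0 hd] := near_mdist (usc_near ulam xc).
pose K : R := `|c| / d; have K0 : 0 <= K by rewrite divr_ge0// ltW.
exists K; apply: (represents_le lm) => y r ry.
rewrite /= /peak; have r0 : r <= 0.
  by rewrite -lee_fin; exact: le_trans (lam_le0 y).
have Kxy : 0 <= K * mdist x y := mulr_ge0 K0 (mdist_ge0 x y).
have [xy|xy] := ltP (mdist x y) d.
  have : r < c.
    by rewrite -lte_fin; apply: le_lt_trans ry _; exact: hd.
  by lra.
have : `|c| <= K * mdist x y.
  by rewrite /K mulrAC ler_pdivlMr// ler_wpM2l.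
by have := ler_norm (- c); rewrite normrN; lra.
Qed.

(** Words almost realizing [S(x, z)] lead from [z] to points converging to [x],
where [lam] is almost at least [S(x, z) + lam z]. *)
Lemma mane_add_le x z : superinvariant S lam ->
  (mane S x z + lam z <= lam x)%E.
Proof.
move=> hlam.
case Es : (mane S x z) (mane_le0 S x z) => [s| |]//= _; last first.
  by rewrite addNye leNye.
case Et : (lam z) (lam_le0 z) => [t| |]//= _; last by rewrite addeNy leNye.
rewrite -EFinD; apply: lee_of_lt_reals => c xc; apply/ler_addgt0Pr => e e0.
have [d d0 hd] := near_mdist (usc_near ulam xc).
have /mane_geP hs : (s%:E <= mane S x z)%E by rewrite Es.
have [|w [_]] := hs (Num.min d e); first by rewrite lt_min d0.
rewrite lt_min => /andP[dw _] sw.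
have {}sw : s - e < sum_word S w z.
  by apply: le_lt_trans sw; rewrite lerD2l lerN2 ge_min lexx orbT.
have : t + sum_word S w z < c.
  rewrite -lte_fin EFinD -Et.
  apply: le_lt_trans (superinvariant_word w z hlam) _.
  exact: hd.
by lra.
Qed.

Context (inv_mu : invariant_functional S mu).

Lemma invariant_ge j (f : continuousType X R) :
  mu (q S j \+ (f \o phi S j)) <= mu f.
Proof.
by rewrite -lee_fin -(inv_mu f); apply: ereal_sup_ubound; exists j.
Qed.

Lemma superinvariant_of_invariant : superinvariant S lam.
Proof.
move=> j x; rewrite -leeBrDr//; apply: lee_of_reals => r rx.
rewrite leeBrDr// -EFinD; apply: lee_of_lt_reals => c /represents_peak[K].
apply: le_trans; apply: le_trans (invariant_ge j _).
apply: le_trans (represents_ge _ lm rx).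
by rewrite /= /peak mdistxx mulr0 oppr0 addr0.
Qed.

(** Since [lam p.2 + q <= 0], a pair nearly optimal for the peak at [x] cannot
pay the penalty of mapping far from [x]. *)
Lemma approximate_preimage x (r e : R) : lam x = r%:E -> 0 < e ->
  exists p : J * X, mdist x (phi S p.1 p.2) < e /\
    ((r - e - q S p.1 p.2)%:E < lam p.2)%E.
Proof.
move=> xr e0; have r0 : r <= 0 by rewrite -lee_fin -xr.
(* the slope for which the penalty at distance e is e - r *)
pose K : R := (e - r) / e; have K0 : 0 < K by rewrite divr_gt0//; lra.
have : ((r - e)%:E < Mop S mu (peak K x))%E.
  rewrite inv_mu lte_fin; apply: (@lt_le_trans _ _ r); first by lra.
  have rx : (r%:E <= lam x)%E by rewrite xr.
  apply: le_trans (represents_ge (peak K x) lm rx).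
  by rewrite /= /peak mdistxx mulr0 oppr0 addr0.
move=> /ereal_sup_gt[_ [j _ <-]]; rewrite lte_fin.
move=> /(represents_gt lm)[y [t ty /=]]; rewrite /peak => rt.
have t0 : t <= 0 by rewrite -lee_fin; exact: le_trans (lam_le0 y).
have q0 := q_le0 S j y.
have Kd : 0 <= K * mdist x (phi S j y) := mulr_ge0 (ltW K0) (mdist_ge0 _ _).
exists (j, y); split=> /=.
  rewrite -(ltr_pM2l K0).
  have -> : K * e = e - r by rewrite /K divfK ?gt_eqF.
  lra.
by apply: lt_le_trans ty; rewrite lte_fin; lra.
Qed.

(** A cluster point in [J * X] of approximate preimages is exact, because
[(j, y) |-> lam y + q_j y] is upper semicontinuous.  Exactness matters: errors
in the positions would be carried along a backward orbit up to [x]. *)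
Lemma exact_preimage x (r : R) : lam x = r%:E ->
  exists t : J * (X * R), [/\ phi S t.1 t.2.1 = x, lam t.2.1 = t.2.2%:E
    & r <= t.2.2 + q S t.1 t.2.1].
Proof.
move=> xr.
have ninv_gt0 n : 0 < (n.+1%:R : R)^-1 by rewrite invr_gt0.
have [u hu] := choice (fun n => approximate_preimage xr (ninv_gt0 n)).
have cJX : compact [set: J * X].
  rewrite -setXTT; apply: compact_setX; first exact: (mpIFS_compact_index S).
  exact: (mpIFS_compact_space S).
have [[j y] hp] := cluster_sequence u cJX.
have natinv (e : R) (e0 : 0 < e) :
    exists N, forall n, (N <= n)%N -> (n.+1%:R : R)^-1 < e.
  by have [N _ hN] := near_infty_natSinv_lt (PosNum e0); exists N.
have phix : phi S j y = x.
  apply/esym/mdist_positivity/eqP; rewrite eq_le mdist_ge0 andbT.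
  apply/ler_addgt0Pr => e e0; rewrite add0r; have e3 : 0 < e / 3 by lra.
  have [N hN] := natinv _ e3.
  have [|n Nn] := hp (ball j (e / 3) `*` ball y (e / 3)) _ N.
    by exists (ball j (e / 3), ball y (e / 3)) => //; split; exact: nbhsx_ballx.
  rewrite !ballEmdist => -[jn yn].
  have {}jn : mdist j (u n).1 < e / 3 := jn.
  have {}yn : mdist y (u n).2 < e / 3 := yn.
  have [g /andP[g0 g1] Hg] := mpIFS_contractive S.
  have := Hg (u n).1 j (u n).2 y.
  have := metric_triangle x (phi S (u n).1 (u n).2) (phi S j y).
  rewrite (metric_sym (u n).1) (metric_sym (u n).2) => h1 h2.
  have h3 : g * (mdist j (u n).1 + mdist y (u n).2) <=
      mdist j (u n).1 + mdist y (u n).2.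
    by rewrite ler_piMl ?addr_ge0 ?mdist_ge0// ltW.
  by have := lt_trans (hu n).1 (hN _ Nn); lra.
have ylam : ((r - q S j y)%:E <= lam y)%E.
  apply: lee_of_lt_reals => c yc; apply/ler_addgt0Pr => e e0.
  have e2 : 0 < e / 2 by lra.
  have [N hN] := natinv _ e2.
  have /cvgrPdist_lt/(_ _ e2) hq := @mpIFS_continuous _ _ _ S (j, y).
  have hl : \forall p \near (j, y), (lam p.2 < c%:E)%E.
    exact: (@cvg_snd _ _ (nbhs j) (nbhs y) _ _ (usc_near ulam yc)).
  have [n Nn [/= qn ln]] := hp _ (filterI hq hl) N.
  have {}qn : `|q S j y - q S (u n).1 (u n).2| < e / 2 := qn.
  have := lt_trans (hu n).2 ln; rewrite lte_fin.
  move: (hN _ Nn) qn; rewrite ltr_norml; set i := _^-1; lra.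
case Ey : (lam y) ylam (lam_le0 y) => [t| |]//; rewrite lee_fin => rt _.
by exists (j, (y, t)); split=> //=; lra.
Qed.

Lemma backward_orbit x (r : R) : lam x = r%:E ->
  exists (xs : nat -> X) (js : nat -> J) (L : nat -> R),
    [/\ xs 0%N = x, forall n, lam (xs n) = (L n)%:E,
      forall n, phi S (js n) (xs n.+1) = xs n
    & forall n, L n <= L n.+1 + q S (js n) (xs n.+1)].
Proof.
move=> xr.
(* t0 is only a default value for the choice function *)
have [t0 _] := exact_preimage xr.
have /choice[F hF] : forall s : X * R, exists t : J * (X * R),
    lam s.1 = s.2%:E -> [/\ phi S t.1 t.2.1 = s.1, lam t.2.1 = t.2.2%:E
      & s.2 <= t.2.2 + q S t.1 t.2.1].
  move=> s; have [/exact_preimage[t ht]|ns] := pselect (lam s.1 = s.2%:E).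
    by exists t.
  by exists t0.
pose s n := iter n (fun s => (F s).2) (x, r).
have hs n : lam (s n).1 = (s n).2%:E by elim: n => //= n /hF[].
exists (fun n => (s n).1), (fun n => (F (s n)).1), (fun n => (s n).2).
by split=> // n; have [] := hF _ (hs n).
Qed.

Lemma orbit_word (xs : nat -> X) (js : nat -> J) (L : nat -> R) m k :
  (forall n, phi S (js n) (xs n.+1) = xs n) ->
  (forall n, L n <= L n.+1 + q S (js n) (xs n.+1)) ->
  phi_word S (map js (iota m k)) (xs (m + k)%N) = xs m /\
  L m <= L (m + k)%N + sum_word S (map js (iota m k)) (xs (m + k)%N).
Proof.
move=> hphi hL; elim: k m => [|k IH] m /=; first by rewrite addn0 addr0.
have [h1 h2] := IH m.+1; rewrite -addSnnS h1; split=> //.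
by have := hL m; lra.
Qed.

(** The point [z] is a cluster point of a backward orbit of [x].  As [lam]
converges along the orbit, the words joining two of its visits near [z] have
sums close to [0]; moving their end points to [z] puts [z] in the Aubry set. *)
Lemma aubry_attains x (r : R) : lam x = r%:E ->
  exists2 z, Aubry S z & (lam x <= mane S x z + lam z)%E.
Proof.
move=> xr; have [xs [js [L [x0 hlam hphi hL]]]] := backward_orbit xr.
have hw m k := orbit_word m k hphi hL.
have Lmono m k : L m <= L (m + k)%N.
  have := sum_word_le0 S (map js (iota m k)) (xs (m + k)%N).
  by have [_] := hw m k; lra.
have supL : has_sup (range L).
  split; first by exists (L 0%N), 0%N.
  by exists 0 => _ [n _ <-]; rewrite -lee_fin -hlam.
pose l := sup (range L).
have Lle n : L n <= l by apply: sup_upper_bound => //; exists n.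
have Lge (e : R) : 0 < e -> exists N, forall n, (N <= n)%N -> l - e < L n.
  move=> e0; have [_ [N _ <-] lN] := sup_adherent e0 supL.
  by exists N => n /subnKC <-; apply: lt_le_trans lN _.
have [z hz] := cluster_sequence xs (mpIFS_compact_space S).
have near_z (d : R) N : 0 < d -> exists2 n, (N <= n)%N & mdist z (xs n) < d.
  move=> d0; have [n Nn] := hz _ (nbhsx_ballx z d d0) N.
  by rewrite ballEmdist; exists n.
have [D D0 HD] := sum_word_lipschitz S.
(* distances lose at most 2 d; sums lose at most d from the values of L and D d
   from moving the end point *)
have scale (e : R) : 0 < e -> exists2 d, 0 < d & 2 * d + D * d = e.
  have D2 : 0 < 2 + D by rewrite addr_gt0.
  move=> e0; exists (e / (2 + D)); first by rewrite divr_gt0.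
  by rewrite -mulrDl mulrC divfK ?gt_eqF.
have move_end w n d : mdist z (xs n) < d ->
    mdist (phi_word S w (xs n)) (phi_word S w z) < d /\
    sum_word S w (xs n) - D * d < sum_word S w z.
  rewrite metric_sym => zn; split.
    exact: le_lt_trans (phi_word_nonexpansive _ _ _ _) zn.
  have := HD w (xs n) z; rewrite -(ltr_pM2l D0) in zn.
  by rewrite ler_norml; lra.
exists z.
  apply/eqP; rewrite eq_le mane_le0 /=; apply/mane_geP => e e0.
  have [d d0 de] := scale _ e0; have Dd : 0 < D * d by rewrite mulr_gt0.
  have [N hN] := Lge _ d0.
  have [m Nm zm] := near_z d N d0; have [n mn zn] := near_z d m.+1 d0.
  exists (map js (iota m (n - m))); rewrite size_map size_iota subn_gt0.
  have [h1 h2] := hw m (n - m)%N; rewrite subnKC 1?ltnW// in h1 h2.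
  have [h3 h4] := move_end (map js (iota m (n - m))) _ _ zn.
  rewrite h1 in h3; split=> //.
    have := metric_triangle z (xs m) (phi_word S (map js (iota m (n - m))) z).
    by lra.
  by have := hN _ Nm; have := Lle n; lra.
have lz : (l%:E <= lam z)%E.
  apply: lee_of_lt_reals => c zc; apply/ler_addgt0Pr => e e0.
  have [N hN] := Lge _ e0; have [n Nn] := hz _ (usc_near ulam zc) N.
  by rewrite hlam lte_fin; have := hN _ Nn; lra.
have xz : ((L 0%N - l)%:E <= mane S x z)%E.
  apply/mane_geP => e e0.
  have [d d0 de] := scale _ e0; have Dd : 0 < D * d by rewrite mulr_gt0.
  have [n n0 zn] := near_z d 1%N d0.
  exists (map js (iota 0 n)); rewrite size_map size_iota.
  have [h1 h2] := hw 0%N n; rewrite add0n in h1 h2.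
  have [h3 h4] := move_end (map js (iota 0 n)) _ _ zn.
  rewrite h1 x0 in h3; split=> //; first by lra.
  by have := Lle n; lra.
rewrite -x0 hlam x0; apply: le_trans (leeD xz lz).
by rewrite -EFinD lee_fin; lra.
Qed.

End Invariant.

Local Open Scope ereal_scope.

Theorem theorem3p6 (R : realType) (X J : metricType R) (S : mpIFS X J) :
  (forall lam : X -> \bar R,
     (forall x, lam x <= 0) ->
     ereal_sup [set lam x | x in [set: X]] = 0 ->
     (forall x, lam x = ereal_sup [set mane S x z + lam z | z in Aubry S]) ->
     exists mu : continuousType X R -> R,
       [/\ represents lam mu, idempotent_probability mu
         & invariant_functional S mu]) /\
  (forall (mu : continuousType X R -> R) (lam : X -> \bar R),
     idempotent_probability mu -> invariant_functional S mu ->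
     density lam mu ->
     forall x, lam x = ereal_sup [set mane S x z + lam z | z in Aubry S]).
Proof.
split=> [lam lam0 sup0 H|mu lam [_ mu0] inv_mu [[_ ulam _] lm] x].
  have [mu lm] := represents_exists (mpIFS_compact_space S) sup0.
  exists mu; split=> //; last exact: invariant_of_mane.
  split; first exact: represents_linear lm.
  by apply: EFin_inj; rewrite (represents_cst0 lm).
have lam_le0 y : lam y <= 0.
  rewrite -[leRHS]/(0%:E) -mu0 (represents_cst0 lm).
  by apply: ereal_sup_ubound; exists y.
have hlam := superinvariant_of_invariant lam_le0 ulam lm inv_mu.
apply/eqP; rewrite eq_le; apply/andP; split.
  case Ex : (lam x) (lam_le0 x) => [r| |] // _; last exact: leNye.
  rewrite -Ex; have [z zA h] := aubry_attains lam_le0 ulam lm inv_mu Ex.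
  by apply: le_trans h _; apply: ereal_sup_ubound; exists z.
by apply: ge_ereal_sup => _ [z _ <-]; exact: mane_add_le.
Qed.
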